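(* Fix constants $m_0>0$, $\phi_0(1)=-\phi_0(-1)>0$ and $0<\gamma_{max}<\infty$ (independent of $\varepsilon$), and set $M=\sqrt{\frac{m_0}{2e^{\phi_0(1)}}}$ and $K_0=\sup_{0<|y|\le \phi_0(1)}\frac{|e^y-1|}{|y|}$. There exists $\tilde\varepsilon>0$, depending only on $m_0$ and $\phi_0(1)$, such that the following holds for every $0<\varepsilon<\tilde\varepsilon$. Suppose that $$0<\gamma_\varepsilon\le\gamma_{max},\qquad \frac{\gamma_\varepsilon}{\sqrt\varepsilon}>\frac{\left((1+2\gamma_{max})^2+3\right)K_0\phi_0(1)}{4M},$$ and let $(\tilde\delta,\tilde\eta,\tilde\phi)$ be a solution of the linearized perturbed problem (LP) of the context whose initial data satisfy $\int_{-1}^1\tilde\delta(x,0)\,dx=\int_{-1}^1\tilde\eta(x,0)\,dx=0$. Then, with $\bar D,\bar H,d,h$ as defined in the context, $$\frac{d}{dt}\left[\frac12\int_{-1}^1(\bar D^2+\bar H^2)\,dx+d^2+h^2\right]\le-\int_{-1}^1\left(\bar D_x^2+\frac12\bar H_x^2\right)dx-\frac1\varepsilon m_{0,\varepsilon}\int_{-1}^1\bar D^2\,dx$$ for all $t>0$, where $m_{0,\varepsilon}=m_0\left[1-K_0\phi_0(1)\frac{\sqrt\varepsilon}{M}\right]>\frac{m_0}{2}$.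
   Context: Boundary layer steady state. For $\varepsilon>0$, $\gamma_\varepsilon>0$ (a constant depending on $\varepsilon$), $m_0>0$ and constants $\phi_0(1)=-\phi_0(-1)>0$, let $\psi$ be the solution of $$\varepsilon\psi_{xx}=\frac{m_0e^{\psi}}{\int_{-1}^1e^{\psi}dx}-\frac{m_0e^{-\psi}}{\int_{-1}^1e^{-\psi}dx}\ \text{ in }(-1,1),\qquad \psi(\pm1)\pm\gamma_\varepsilon\psi_x(\pm1)=\phi_0(\pm1).$$ Put $n^0=\frac{m_0e^{\psi}}{\int_{-1}^1e^{\psi}dx}$, $p^0=\frac{m_0e^{-\psi}}{\int_{-1}^1e^{-\psi}dx}$, $\delta^0=n^0-p^0$, $\eta^0=n^0+p^0$. Linearized perturbed problem (LP), for unknowns $(\tilde\delta,\tilde\eta,\tilde\phi)$ depending on $x\in(-1,1)$, $t>0$: $$\tilde\delta_t=\tilde\delta_{xx}-(\eta^0\tilde\phi_x)_x-(\tilde\eta\psi_x)_x,\quad \tilde\eta_t=\tilde\eta_{xx}-(\delta^0\tilde\phi_x)_x-(\tilde\delta\psi_x)_x,\quad \varepsilon\tilde\phi_{xx}=\tilde\delta,$$ with boundary conditions $$\tilde\delta_x-\eta^0\tilde\phi_x-\tilde\eta\psi_x=\tilde\eta_x-\delta^0\tilde\phi_x-\tilde\delta\psi_x=0\ \text{ at }x=\pm1,\qquad \tilde\phi\pm\gamma_\varepsilon\tilde\phi_x=0\ \text{ at }x=\pm1.$$ Notation: $D(x,t)=\int_{-1}^x\tilde\delta(s,t)\,ds$,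 $H(x,t)=\int_{-1}^x\tilde\eta(s,t)\,ds$, $d(t)=\frac12\int_{-1}^1D(x,t)\,dx$, $h(t)=\frac12\int_{-1}^1H(x,t)\,dx$, $\bar D=D-d$, $\bar H=H-h$. *)

(* Defs.v *)
From Stdlib Require Import Reals.
From Coquelicot Require Import Coquelicot.
Open Scope R_scope.

Definition I11 (x : R) : Prop := -1 <= x <= 1.

(** Space derivatives are taken relative to the closed interval [-1,1]: they are
    the usual derivatives inside and the one-sided derivatives at x = -1 and
    x = 1. Values of [f] outside [-1,1] play no role. As with [RInt], [deriv_I] is
    total and is meaningful only under [ex_deriv_I]. *)
Definition is_deriv_I (f : R -> R) (x l : R) : Prop :=
  filterdiff f (within I11 (locally x)) (fun h : R => scal h l).
Definition ex_deriv_I (f : R -> R) (x : R) : Prop := exists l : R, is_deriv_I f x l.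
Definition deriv_I (f : R -> R) (x : R) : R := iota (is_deriv_I f x).

Definition C2_closed (f : R -> R) : Prop :=
  (forall x, I11 x -> ex_deriv_I f x /\ ex_deriv_I (deriv_I f) x) /\
  continuous_on I11 (deriv_I (deriv_I f)).

(** Functions of (x,t) are curried: [u x t]. *)
Definition d_x (u : R -> R -> R) (x t : R) : R := deriv_I (fun y => u y t) x.
Definition d_xx (u : R -> R -> R) : R -> R -> R := d_x (d_x u).
Definition d_t (u : R -> R -> R) (x t : R) : R := Derive (fun s => u x s) t.

Definition cylinder (p : R * R) : Prop := I11 (fst p) /\ 0 < snd p.

Definition jointly_continuous (u : R -> R -> R) : Prop :=
  continuous_on cylinder (fun p : R * R => u (fst p) (snd p)).

(** C^{2,1}([-1,1] x (0,+oo)). *)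
Definition C21 (u : R -> R -> R) : Prop :=
  (forall x t, I11 x -> 0 < t ->
     ex_deriv_I (fun y => u y t) x /\ ex_deriv_I (fun y => d_x u y t) x /\
     ex_derive (fun s => u x s) t) /\
  jointly_continuous u /\ jointly_continuous (d_x u) /\
  jointly_continuous (d_xx u) /\ jointly_continuous (d_t u).

(** The initial values [u x 0] are attained in L^1(-1,1). *)
Definition attains_initial_data (u : R -> R -> R) : Prop :=
  ex_RInt (fun x => u x 0) (-1) 1 /\
  filterlim (fun t => RInt (fun x => Rabs (u x t - u x 0)) (-1) 1)
    (at_right 0) (locally 0).

Definition n0 (m0 : R) (psi : R -> R) (x : R) : R :=
  m0 * exp (psi x) / RInt (fun y => exp (psi y)) (-1) 1.
Definition p0 (m0 : R) (psi : R -> R) (x : R) : R :=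
  m0 * exp (- psi x) / RInt (fun y => exp (- psi y)) (-1) 1.
Definition delta0 (m0 : R) (psi : R -> R) (x : R) : R := n0 m0 psi x - p0 m0 psi x.
Definition eta0 (m0 : R) (psi : R -> R) (x : R) : R := n0 m0 psi x + p0 m0 psi x.

(** [phi1] stands for phi_0(1), so that phi_0(-1) = - phi1. *)
Definition steady_state (eps gamma m0 phi1 : R) (psi : R -> R) : Prop :=
  C2_closed psi /\
  (forall x, -1 < x < 1 -> eps * deriv_I (deriv_I psi) x = n0 m0 psi x - p0 m0 psi x) /\
  psi 1 + gamma * deriv_I psi 1 = phi1 /\
  psi (-1) - gamma * deriv_I psi (-1) = - phi1.

Definition LP_equations (eps m0 : R) (psi : R -> R) (delta eta phi : R -> R -> R) : Prop :=
  forall x t, -1 < x < 1 -> 0 < t ->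
    d_t delta x t =
      d_xx delta x t
      - d_x (fun y s => eta0 m0 psi y * d_x phi y s) x t
      - d_x (fun y s => eta y s * deriv_I psi y) x t /\
    d_t eta x t =
      d_xx eta x t
      - d_x (fun y s => delta0 m0 psi y * d_x phi y s) x t
      - d_x (fun y s => delta y s * deriv_I psi y) x t /\
    eps * d_xx phi x t = delta x t.

Definition LP_no_flux (m0 : R) (psi : R -> R) (delta eta phi : R -> R -> R) : Prop :=
  forall x t, x = -1 \/ x = 1 -> 0 < t ->
    d_x delta x t - eta0 m0 psi x * d_x phi x t - eta x t * deriv_I psi x = 0 /\
    d_x eta x t - delta0 m0 psi x * d_x phi x t - delta x t * deriv_I psi x = 0.

Definition LP_robin (gamma : R) (phi : R -> R -> R) : Prop :=
  forall t, 0 < t ->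
    phi 1 t + gamma * d_x phi 1 t = 0 /\
    phi (-1) t - gamma * d_x phi (-1) t = 0.

(** Solutions are classical for t > 0; no time regularity of [phi] is asked for,
    since time enters its equation only through [delta]. *)
Definition LP_solution (eps gamma m0 : R) (psi : R -> R)
    (delta eta phi : R -> R -> R) : Prop :=
  C21 delta /\ C21 eta /\ (forall t, 0 < t -> C2_closed (fun x => phi x t)) /\
  attains_initial_data delta /\ attains_initial_data eta /\
  LP_equations eps m0 psi delta eta phi /\
  LP_no_flux m0 psi delta eta phi /\
  LP_robin gamma phi.

(** With [u] = delta or eta: [prim u] is D or H, [prim_mean u] is d or h, and
    [prim_bar u] is D-bar or H-bar. *)
Definition prim (u : R -> R -> R) (x t : R) : R := RInt (fun s => u s t) (-1) x.
Definition prim_mean (u : R -> R -> R) (t : R) : R :=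
  1 / 2 * RInt (fun x => prim u x t) (-1) 1.
Definition prim_bar (u : R -> R -> R) (x t : R) : R := prim u x t - prim_mean u t.

Definition energy (delta eta : R -> R -> R) (t : R) : R :=
  1 / 2 * RInt (fun x => prim_bar delta x t ^ 2 + prim_bar eta x t ^ 2) (-1) 1
  + prim_mean delta t ^ 2 + prim_mean eta t ^ 2.

Definition cM (m0 phi1 : R) : R := sqrt (m0 / (2 * exp phi1)).

(** The set is nonempty and bounded for [phi1 > 0], so its supremum in [Rbar] is
    finite and the coercion to [R] loses nothing. *)
Definition cK0 (phi1 : R) : R :=
  real (Lub_Rbar (fun r : R =>
    exists y : R, 0 < Rabs y <= phi1 /\ r = Rabs (exp y - 1) / Rabs y)).

Definition m0eps (m0 phi1 eps : R) : R :=
  m0 * (1 - cK0 phi1 * phi1 * (sqrt eps / cM m0 phi1)).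

(* Main.v *)
Require Import Defs.
From Stdlib Require Import Reals Lra Psatz.
From Coquelicot Require Import Coquelicot.
Open Scope R_scope.

(** Conservation of mass makes the primitives D and H vanish at both ends, and
    the energy is half the squared L^2 norm of (D, H): the means d and h only
    split it. Since D_t and H_t are the two fluxes, the time derivative of the
    energy is an integral at a fixed time.

    Integrating Poisson's equation gives eps phi_x = D + c, and the Robin
    conditions give c = - d / (1 + gamma) ([perturbed_field]). With
    eps psi_xx = delta^0 the drift terms that couple D and H cancel up to
    c psi_x H_x. What is left besides the dissipation is
    - (1/eps) int eta^0 (D + c) D, which is coercive in Dbar because eta^0 is
    bounded below by mu = m_{0,eps}, and coercive in d because the Robin
    constant gamma > 0 leaves the term 2 m0 d (d + c) / eps. The latter must
    absorb the cross terms, which requires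
    (1 + 2 gamma)^2 (m0 - mu) + eps int psi_x^2 <= 4 m0 gamma (1 + gamma);
    this is [dissipation_inequality].

    Both facts about the layer, that eta^0 >= mu and that the condition above
    follows from the lower bound on gamma / sqrt eps, come from one estimate:
    with a = K_0 phi_0(1) sqrt eps / M, so that mu = m0 (1 - a),
    eps int psi_x^2 <= 3 m0 a ([field_energy_bound]). Indeed
    eps psi_x^2 / 2 - eta^0 is constant ([pressure_balance]), and taking means
    gives eta^0 >= m0 - (eps / 4) int psi_x^2. For the energy
    bound, charge neutrality gives equal fields at the two ends, hence
    psi(1) = - psi(-1), and the pressure balance then shows that the two
    Boltzmann normalizations agree and bounds the boundary field. *)

(** Integrals live in the carrier of a normed module; the algebraic tactics
    need to see that it is the real line. *)
Ltac eq_R := match goal with |- @eq _ ?x ?y => change (@eq R x y) end.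

(** * Calculus on the closed interval *)

(** Composing with the retraction of the line onto [-1,1] turns continuity
    relative to the interval into plain continuity on the line, which is what
    the theory of the Riemann integral asks for. *)
Definition clamp (x : R) : R := Rmax (-1) (Rmin 1 x).

Definition continuous_I (f : R -> R) : Prop :=
  forall x, continuous (fun y => f (clamp y)) x.

(** Asking for the derivative only inside, and for continuity up to the
    endpoints, is all that the fundamental theorem needs, and it avoids
    one-sided derivatives. *)
Definition C1I (f f' : R -> R) : Prop :=
  continuous_I f /\ continuous_I f' /\
  forall x, -1 < x < 1 -> is_derive f x (f' x).

Lemma clamp_in x : I11 (clamp x).
Proof.
  unfold I11, clamp. split.
  - apply Rmax_l.
  - apply Rmax_lub; [lra | apply Rmin_l].
Qed.

Lemma clamp_id x : I11 x -> clamp x = x.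
Proof.
  intros [H1 H2]. unfold clamp. rewrite Rmin_right, Rmax_right; lra.
Qed.

Lemma clamp_lipschitz x y : Rabs (clamp y - clamp x) <= Rabs (y - x).
Proof.
  unfold clamp, Rmax, Rmin.
  repeat destruct Rle_dec; unfold Rabs; repeat destruct Rcase_abs; lra.
Qed.

Lemma clamp_lim x : filterlim clamp (locally x) (within I11 (locally (clamp x))).
Proof.
  intros P [d Hd]. exists d. intros y Hy. apply Hd; [| apply clamp_in].
  apply Rle_lt_trans with (2 := Hy). apply clamp_lipschitz.
Qed.

Lemma locally_inside x : -1 < x < 1 -> locally x (fun y => -1 < y < 1).
Proof.
  intros Hx. apply (open_and _ _ (open_gt (-1)) (open_lt 1)). lra.
Qed.

Lemma continuous_on_clamp f : continuous_on I11 f -> continuous_I f.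
Proof.
  intros Hf x. eapply filterlim_comp; [apply clamp_lim |].
  apply Hf, clamp_in.
Qed.

Lemma continuous_I_ext f g :
  (forall x, I11 x -> f x = g x) -> continuous_I f -> continuous_I g.
Proof.
  intros E Hf x. apply continuous_ext with (2 := Hf x).
  intros y. apply E, clamp_in.
Qed.

Lemma continuous_I_const c : continuous_I (fun _ => c).
Proof. intros x. apply continuous_const. Qed.

Lemma continuous_I_global f : (forall x, continuous f x) -> continuous_I f.
Proof.
  intros Hf x. apply (continuous_comp clamp f); [| apply Hf].
  intros P HP. destruct (clamp_lim x (fun y => P y)) as [d Hd].
  - destruct HP as [d Hd]. exists d. auto.
  - exists d. exact Hd.
Qed.

Lemma continuous_I_plus f g :
  continuous_I f -> continuous_I g -> continuous_I (fun x => f x + g x).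
Proof. intros Hf Hg x. apply (continuous_plus _ _ _ (Hf x) (Hg x)). Qed.

Lemma continuous_I_mult f g :
  continuous_I f -> continuous_I g -> continuous_I (fun x => f x * g x).
Proof. intros Hf Hg x. apply (continuous_mult _ _ _ (Hf x) (Hg x)). Qed.

Lemma continuous_I_opp f : continuous_I f -> continuous_I (fun x => - f x).
Proof. intros Hf x. apply (continuous_opp _ _ (Hf x)). Qed.

Lemma continuous_I_minus f g :
  continuous_I f -> continuous_I g -> continuous_I (fun x => f x - g x).
Proof. intros Hf Hg x. apply (continuous_minus _ _ _ (Hf x) (Hg x)). Qed.

Lemma continuous_I_div f c : continuous_I f -> continuous_I (fun x => f x / c).
Proof. intros Hf. apply continuous_I_mult; [exact Hf | apply continuous_I_const]. Qed.

Lemma continuous_I_pow f n : continuous_I f -> continuous_I (fun x => f x ^ n).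
Proof.
  intros Hf. induction n as [|n IH]; simpl.
  - apply continuous_I_const.
  - now apply continuous_I_mult.
Qed.

Lemma continuous_I_exp f : continuous_I f -> continuous_I (fun x => exp (f x)).
Proof. intros Hf x. apply continuous_exp_comp, Hf. Qed.

Create HintDb contI.
#[global] Hint Resolve continuous_I_const continuous_I_plus continuous_I_mult
  continuous_I_opp continuous_I_minus continuous_I_div continuous_I_pow
  continuous_I_exp : contI.

Lemma between_inside a b x :
  I11 a -> I11 b -> Rmin a b < x < Rmax a b -> -1 < x < 1.
Proof.
  unfold I11, Rmin, Rmax. destruct Rle_dec; lra.
Qed.

Lemma I11_left : I11 (-1). Proof. unfold I11; lra. Qed.
Lemma I11_right : I11 1. Proof. unfold I11; lra. Qed.
Lemma I11_inside x : -1 < x < 1 -> I11 x. Proof. unfold I11; lra. Qed.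
#[global] Hint Resolve I11_left I11_right I11_inside : contI.

Lemma RInt_clamp (f : R -> R) a b :
  I11 a -> I11 b -> RInt (fun x => f (clamp x)) a b = RInt f a b.
Proof.
  intros Ha Hb. apply RInt_ext. intros x Hx.
  rewrite clamp_id; [easy |]. apply I11_inside, (between_inside a b); easy.
Qed.

Lemma ex_RInt_I (f : R -> R) a b : I11 a -> I11 b -> continuous_I f -> ex_RInt f a b.
Proof.
  intros Ha Hb Hf. apply ex_RInt_ext with (fun x => f (clamp x)).
  - intros x Hx. rewrite clamp_id; [easy |].
    apply I11_inside, (between_inside a b); easy.
  - apply (@ex_RInt_continuous R_CompleteNormedModule). intros z _. apply Hf.
Qed.

Lemma RInt_I_ext (f g : R -> R) :
  (forall x, -1 < x < 1 -> f x = g x) -> RInt f (-1) 1 = RInt g (-1) 1.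
Proof.
  intros E. apply RInt_ext. intros x Hx. apply E.
  now apply (between_inside (-1) 1); auto with contI.
Qed.

Lemma RInt_I_plus f g : continuous_I f -> continuous_I g ->
  RInt (fun x => f x + g x) (-1) 1 = RInt f (-1) 1 + RInt g (-1) 1.
Proof. intros Hf Hg. apply (RInt_plus f g); apply ex_RInt_I; auto with contI. Qed.

Lemma RInt_I_minus f g : continuous_I f -> continuous_I g ->
  RInt (fun x => f x - g x) (-1) 1 = RInt f (-1) 1 - RInt g (-1) 1.
Proof. intros Hf Hg. apply (RInt_minus f g); apply ex_RInt_I; auto with contI. Qed.

Lemma RInt_I_scal c f : continuous_I f ->
  RInt (fun x => c * f x) (-1) 1 = c * RInt f (-1) 1.
Proof. intros Hf. apply (RInt_scal f (-1) 1 c). apply ex_RInt_I; auto with contI. Qed.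

Lemma RInt_I_const (c : R) : RInt (fun _ => c) (-1) 1 = 2 * c.
Proof. rewrite (@RInt_const R_CompleteNormedModule). change ((1 - -1) * c = 2 * c). ring. Qed.

Lemma RInt_I_le f g : continuous_I f -> continuous_I g ->
  (forall x, -1 < x < 1 -> f x <= g x) -> RInt f (-1) 1 <= RInt g (-1) 1.
Proof.
  intros Hf Hg Hle. apply RInt_le; [lra | | | exact Hle]; apply ex_RInt_I; auto with contI.
Qed.

Lemma RInt_I_ge0 f : continuous_I f ->
  (forall x, -1 < x < 1 -> 0 <= f x) -> 0 <= RInt f (-1) 1.
Proof.
  intros Hf Hle. rewrite <- (Rmult_0_r 2), <- (RInt_I_const 0).
  apply RInt_I_le; auto with contI.
Qed.

Lemma RInt_I_gt0 f : continuous_I f ->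
  (forall x, 0 < f x) -> 0 < RInt f (-1) 1.
Proof.
  intros Hf Hpos. rewrite <- RInt_clamp by auto with contI.
  apply RInt_gt_0; [lra | |]; auto.
Qed.

(** The fundamental theorem up to the endpoints: the primitive of the clamped
    derivative and [f] have the same derivative inside, and both are
    continuous up to the boundary. *)
Lemma RInt_deriv f f' a b :
  C1I f f' -> I11 a -> I11 b -> RInt f' a b = f b - f a.
Proof.
  intros (Hf & Hf' & Hd) Ha Hb.
  rewrite <- RInt_clamp by easy.
  set (g := fun x => f' (clamp x)).
  set (G := fun x => RInt g a x).
  assert (HG : forall x, is_derive G x (g x)).
  { intros x. apply is_derive_RInt with a; [| apply Hf'].
    apply filter_forall. intros y. apply (@RInt_correct R_CompleteNormedModule).
    apply (@ex_RInt_continuous R_CompleteNormedModule). intros z _. apply Hf'. }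
  destruct (MVT_gen (fun x => minus (f (clamp x)) (G x)) a b (fun _ => 0))
    as [c [_ Hc]].
  - intros x Hx. apply (between_inside a b) in Hx; [| easy | easy].
    replace 0 with (minus (f' x) (g x))
      by (unfold g; rewrite clamp_id by auto with contI; apply Rminus_diag_eq; reflexivity).
    apply (is_derive_minus (fun x => f (clamp x)) G); [| apply HG].
    apply is_derive_ext_loc with (2 := Hd x Hx).
    apply filter_imp with (2 := locally_inside x Hx).
    intros y Hy. rewrite clamp_id; auto with contI.
  - intros x _. apply continuity_pt_filterlim.
    apply (continuous_minus (fun x => f (clamp x)) G); [apply Hf |].
    apply (@ex_derive_continuous R_AbsRing R_NormedModule). now exists (g x).
  - revert Hc. unfold minus, plus, opp; simpl. rewrite !clamp_id by easy.
    unfold G at 2. rewrite RInt_point. unfold zero; simpl. unfold G. lra.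
Qed.

Lemma C1I_const_of_zero f f' a b :
  C1I f f' -> (forall x, -1 < x < 1 -> f' x = 0) -> I11 a -> I11 b -> f a = f b.
Proof.
  intros Hf Hz Ha Hb. generalize (RInt_deriv f f' a b Hf Ha Hb).
  rewrite (RInt_ext f' (fun _ => 0)).
  - rewrite (@RInt_const R_CompleteNormedModule). change ((b - a) * 0 = f b - f a -> f a = f b). lra.
  - intros x Hx. apply Hz, (between_inside a b); easy.
Qed.

Lemma C1I_ext f g f' g' :
  (forall x, I11 x -> f x = g x) -> (forall x, I11 x -> f' x = g' x) ->
  C1I f f' -> C1I g g'.
Proof.
  intros E E' (Hf & Hf' & Hd). split; [| split].
  - now apply continuous_I_ext with f.
  - now apply continuous_I_ext with f'.
  - intros x Hx. rewrite <- E' by auto with contI.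
    apply is_derive_ext_loc with (2 := Hd x Hx).
    apply filter_imp with (2 := locally_inside x Hx).
    intros y Hy. apply E; auto with contI.
Qed.

Lemma C1I_deriv_ext f f' g' :
  (forall x, -1 < x < 1 -> f' x = g' x) -> continuous_I g' ->
  C1I f f' -> C1I f g'.
Proof.
  intros E Hg' (Hf & Hf' & Hd). split; [| split]; [easy | easy |].
  intros x Hx. rewrite <- E by easy. auto.
Qed.

Lemma C1I_const c : C1I (fun _ => c) (fun _ => 0).
Proof.
  split; [| split]; auto with contI. intros x _. apply (@is_derive_const R_AbsRing R_NormedModule).
Qed.

Lemma C1I_plus f f' g g' : C1I f f' -> C1I g g' ->
  C1I (fun x => f x + g x) (fun x => f' x + g' x).
Proof.
  intros (Hf & Hf' & Hd) (Hg & Hg' & He). split; [| split]; auto with contI.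
  intros x Hx. apply (is_derive_plus f g); auto.
Qed.

Lemma C1I_minus f f' g g' : C1I f f' -> C1I g g' ->
  C1I (fun x => f x - g x) (fun x => f' x - g' x).
Proof.
  intros (Hf & Hf' & Hd) (Hg & Hg' & He). split; [| split]; auto with contI.
  intros x Hx. apply (is_derive_minus f g); auto.
Qed.

Lemma C1I_mult f f' g g' : C1I f f' -> C1I g g' ->
  C1I (fun x => f x * g x) (fun x => f' x * g x + f x * g' x).
Proof.
  intros (Hf & Hf' & Hd) (Hg & Hg' & He). split; [| split]; auto 6 with contI.
  intros x Hx. apply (is_derive_mult f g); auto. apply Rmult_comm.
Qed.

Lemma C1I_scal c f f' : C1I f f' -> C1I (fun x => c * f x) (fun x => c * f' x).
Proof.
  intros (Hf & Hf' & Hd). split; [| split]; auto with contI.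
  intros x Hx. apply (is_derive_scal f); auto.
Qed.

Lemma C1I_exp f f' : C1I f f' -> C1I (fun x => exp (f x)) (fun x => f' x * exp (f x)).
Proof.
  intros (Hf & Hf' & Hd). split; [| split]; auto with contI.
  intros x Hx. apply (is_derive_comp exp f); [apply is_derive_exp | auto].
Qed.

#[global] Hint Resolve C1I_const C1I_plus C1I_minus C1I_mult C1I_scal C1I_exp : contI.

(** * Relative derivatives *)

Lemma ex_deriv_I_continuous f x :
  ex_deriv_I f x -> I11 x -> filterlim f (within I11 (locally x)) (locally (f x)).
Proof.
  intros [l [_ Hl]] Hx.
  assert (HF : ProperFilter (within I11 (locally x))).
  { constructor.
    - intros P [d Hd]. exists x. apply Hd; [apply ball_center | exact Hx].
    - apply within_filter, locally_filter. }
  assert (Hlim : is_filter_lim (within I11 (locally x)) x).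
  { intros P [d Hd]. exists d. auto. }
  specialize (Hl x Hlim (mkposreal 1 Rlt_0_1)).
  apply filterlim_locally. intros e.
  assert (Hd : 0 < e / (2 + Rabs l)).
  { apply Rdiv_lt_0_compat; [apply cond_pos |]. generalize (Rabs_pos l). lra. }
  assert (Hnear : within I11 (locally x) (fun y => Rabs (y - x) < e / (2 + Rabs l))).
  { exists (mkposreal _ Hd). intros y Hy _. exact Hy. }
  generalize (filter_and _ _ Hl Hnear). apply filter_imp.
  intros y [H1 H2].
  unfold norm, minus, scal, plus, opp in H1; simpl in H1.
  unfold abs, mult in H1; simpl in H1.
  change (Rabs (f y - f x) < e).
  apply Rle_lt_trans with ((2 + Rabs l) * Rabs (y - x)).
  - replace (f y - f x) with ((f y + - f x + - ((y + - x) * l)) + (y - x) * l) by ring.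
    eapply Rle_trans; [apply Rabs_triang |].
    rewrite Rabs_mult. generalize (Rabs_pos (y - x)) (Rabs_pos l).
    unfold Rminus in *. nra.
  - generalize (Rabs_pos l); intros Hp.
    apply Rmult_lt_compat_l with (r := 2 + Rabs l) in H2; [| lra].
    replace (e : R) with ((2 + Rabs l) * (e / (2 + Rabs l))) by (field; lra).
    exact H2.
Qed.

Lemma is_deriv_I_inside f x l : -1 < x < 1 -> is_deriv_I f x l <-> is_derive f x l.
Proof.
  intros Hx.
  assert (L : filter_le (locally x) (within I11 (locally x))).
  { intros P HP. change (locally x (fun y => I11 y -> P y)) in HP.
    generalize (filter_and _ _ HP (locally_inside x Hx)).
    apply filter_imp. intros y [H1 H2]. apply H1. auto with contI. }
  split; intros [H1 H2]; split; try easy.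
  - intros y Hy. refine (is_domin_le _ _ _ L). apply H2.
    intros P HP. apply Hy in HP. destruct HP as [d Hd]. exists d. auto.
  - intros y Hy. refine (is_domin_le (F := locally x) _ _ _ _).
    + apply H2. intros P HP. apply L. now apply Hy.
    + intros P [d Hd]. exists d. auto.
Qed.

(** Inside the interval [deriv_I] is the usual derivative. Its values at the
    endpoints enter only through continuity. *)
Lemma deriv_I_inside f x :
  -1 < x < 1 -> ex_deriv_I f x -> is_derive f x (deriv_I f x).
Proof.
  intros Hx [l Hl]. apply is_deriv_I_inside; [exact Hx |].
  replace (deriv_I f x) with l; [exact Hl |]. symmetry.
  apply (@iota_unique _ R_CompleteNormedModule); [| exact Hl].
  intros y Hy. apply is_deriv_I_inside in Hy, Hl; try exact Hx.
  apply is_derive_unique in Hy, Hl. now rewrite <- Hy.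
Qed.

Lemma deriv_I_eq f x l : -1 < x < 1 -> is_derive f x l -> deriv_I f x = l.
Proof.
  intros Hx Hl. apply is_deriv_I_inside in Hl; [| exact Hx].
  assert (H := deriv_I_inside f x Hx (ex_intro _ l Hl)).
  apply is_deriv_I_inside in Hl; [| exact Hx].
  apply is_derive_unique in H, Hl. now rewrite <- H.
Qed.

Lemma C1I_deriv_I f :
  (forall x, I11 x -> ex_deriv_I f x) -> continuous_on I11 (deriv_I f) ->
  C1I f (deriv_I f).
Proof.
  intros Hf Hc. split; [| split].
  - apply continuous_on_clamp. intros x Hx. apply ex_deriv_I_continuous; auto.
  - now apply continuous_on_clamp.
  - intros x Hx. apply deriv_I_inside; auto with contI.
Qed.

Lemma C2_closed_C1I f : C2_closed f ->
  C1I f (deriv_I f) /\ C1I (deriv_I f) (deriv_I (deriv_I f)).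
Proof.
  intros [Hf Hc]. split; apply C1I_deriv_I; try (intros x Hx; now apply Hf); try easy.
  intros x Hx. apply ex_deriv_I_continuous; [now apply Hf | easy].
Qed.

(** * The boundary layer *)

(** The quotients are bounded by e^phi1, so the supremum is finite and
    dominates the quotient at y = phi1. *)
Lemma cK0_bound phi1 : 0 < phi1 -> exp phi1 - 1 <= cK0 phi1 * phi1.
Proof.
  intros Hphi. unfold cK0.
  set (E := fun r : R => exists y : R, 0 < Rabs y <= phi1 /\ r = Rabs (exp y - 1) / Rabs y).
  destruct (Lub_Rbar_correct E) as [Hub Hlub].
  assert (Hmem : E ((exp phi1 - 1) / phi1)).
  { exists phi1. rewrite (Rabs_pos_eq phi1) by lra.
    rewrite Rabs_pos_eq by (generalize (exp_ineq1 phi1); lra).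
    split; [lra | reflexivity]. }
  assert (Hfin : Rbar_le (Lub_Rbar E) (exp phi1)).
  { apply Hlub. intros r (y & Hy & ->). simpl.
    apply Rle_div_l; [lra |].
    (* The tangents of the exponential at 0 and at y give
       y <= e^y - 1 <= y e^y. *)
    assert (H1 := exp_ineq1_le y). assert (H2 := exp_ineq1_le (- y)).
    rewrite exp_Ropp in H2.
    assert (Hexp := exp_pos y).
    assert (H3 : exp y - 1 <= y * exp y).
    { apply Rmult_le_compat_l with (r := exp y) in H2; [| lra].
      rewrite Rinv_r in H2; lra. }
    assert (H4 : y <= phi1) by (generalize (Rle_abs y); lra).
    assert (H5 : exp y <= exp phi1).
    { destruct (Req_dec y phi1) as [-> | Hn]; [lra |].
      left. apply exp_increasing. lra. }
    assert (H6 : 1 <= exp phi1) by (generalize (exp_ineq1 phi1); lra).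
    unfold Rabs. destruct (Rcase_abs (exp y - 1)), (Rcase_abs y); nra. }
  specialize (Hub _ Hmem).
  destruct (Lub_Rbar E) as [r | |]; simpl in *; try easy.
  apply Rle_div_l in Hub; lra.
Qed.

Lemma n0_cont m0 psi : continuous_I psi -> continuous_I (n0 m0 psi).
Proof. intros H. unfold n0. auto 6 with contI. Qed.

Lemma p0_cont m0 psi : continuous_I psi -> continuous_I (p0 m0 psi).
Proof. intros H. unfold p0. auto 6 with contI. Qed.

Lemma delta0_cont m0 psi : continuous_I psi -> continuous_I (delta0 m0 psi).
Proof. intros H. apply continuous_I_minus; [apply n0_cont | apply p0_cont]; easy. Qed.

Lemma eta0_cont m0 psi : continuous_I psi -> continuous_I (eta0 m0 psi).
Proof. intros H. apply continuous_I_plus; [apply n0_cont | apply p0_cont]; easy. Qed.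
#[global] Hint Resolve n0_cont p0_cont delta0_cont eta0_cont : contI.

Lemma boltzmann_mass m0 f : continuous_I f ->
  RInt (fun x => m0 * exp (f x) / RInt (fun y => exp (f y)) (-1) 1) (-1) 1 = m0.
Proof.
  intros Hf. set (I := RInt (fun y => exp (f y)) (-1) 1).
  assert (HI : 0 < I) by (apply RInt_I_gt0; auto with contI; intros; apply exp_pos).
  rewrite (RInt_I_ext _ (fun x => m0 / I * exp (f x))) by (intros; field; lra).
  rewrite RInt_I_scal by auto with contI. fold I. eq_R. field. lra.
Qed.

Lemma n0_mass m0 psi : continuous_I psi -> RInt (n0 m0 psi) (-1) 1 = m0.
Proof. apply boltzmann_mass. Qed.

Lemma p0_mass m0 psi : continuous_I psi -> RInt (p0 m0 psi) (-1) 1 = m0.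
Proof. intros H. apply (boltzmann_mass m0 (fun x => - psi x)). auto with contI. Qed.

Lemma delta0_mass m0 psi : continuous_I psi -> RInt (delta0 m0 psi) (-1) 1 = 0.
Proof.
  intros H. unfold delta0. rewrite RInt_I_minus, n0_mass, p0_mass; auto with contI. eq_R. ring.
Qed.

Lemma eta0_mass m0 psi : continuous_I psi -> RInt (eta0 m0 psi) (-1) 1 = 2 * m0.
Proof.
  intros H. unfold eta0. rewrite RInt_I_plus, n0_mass, p0_mass; auto with contI. eq_R. ring.
Qed.

Lemma eta0_C1I m0 psi psi' : C1I psi psi' ->
  C1I (eta0 m0 psi) (fun x => delta0 m0 psi x * psi' x).
Proof.
  intros H.
  set (Ip := RInt (fun y => exp (psi y)) (-1) 1).
  set (Im := RInt (fun y => exp (- psi y)) (-1) 1).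
  apply C1I_ext with (fun x => m0 / Ip * exp (psi x) + m0 / Im * exp (0 - psi x))
    (fun x => m0 / Ip * (psi' x * exp (psi x)) + m0 / Im * ((0 - psi' x) * exp (0 - psi x))).
  - intros x _. unfold eta0, n0, p0. fold Ip Im. rewrite !Rminus_0_l. unfold Rdiv. ring.
  - intros x _. unfold delta0, n0, p0. fold Ip Im. rewrite !Rminus_0_l. unfold Rdiv. ring.
  - auto 10 with contI.
Qed.

Lemma delta0_C1I m0 psi psi' : C1I psi psi' ->
  C1I (delta0 m0 psi) (fun x => eta0 m0 psi x * psi' x).
Proof.
  intros H.
  set (Ip := RInt (fun y => exp (psi y)) (-1) 1).
  set (Im := RInt (fun y => exp (- psi y)) (-1) 1).
  apply C1I_ext with (fun x => m0 / Ip * exp (psi x) - m0 / Im * exp (0 - psi x))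
    (fun x => m0 / Ip * (psi' x * exp (psi x)) - m0 / Im * ((0 - psi' x) * exp (0 - psi x))).
  - intros x _. unfold delta0, n0, p0. fold Ip Im. rewrite !Rminus_0_l. unfold Rdiv. ring.
  - intros x _. unfold eta0, n0, p0. fold Ip Im. rewrite !Rminus_0_l. unfold Rdiv. ring.
  - auto 10 with contI.
Qed.

(** Both densities have the same mass and log n - log p = 2 (psi - k), so
    psi may be replaced by psi - k, which has the sign of n - p. *)
Lemma delta0_psi_nonneg m0 psi : 0 < m0 -> continuous_I psi ->
  0 <= RInt (fun x => delta0 m0 psi x * psi x) (-1) 1.
Proof.
  intros Hm H.
  set (Ip := RInt (fun y => exp (psi y)) (-1) 1).
  set (Im := RInt (fun y => exp (- psi y)) (-1) 1).
  assert (HIp : 0 < Ip) by (apply RInt_I_gt0; auto with contI; intros; apply exp_pos).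
  assert (HIm : 0 < Im) by (apply RInt_I_gt0; auto with contI; intros; apply exp_pos).
  set (k := (ln Ip - ln Im) / 2).
  replace (RInt _ (-1) 1)
    with (RInt (fun x => delta0 m0 psi x * psi x) (-1) 1 - k * RInt (delta0 m0 psi) (-1) 1)
    by (rewrite delta0_mass by easy; ring).
  rewrite <- RInt_I_scal, <- RInt_I_minus by auto with contI.
  apply RInt_I_ge0; [auto 6 with contI |].
  intros x _.
  assert (E : exp (psi x) / Ip = exp (2 * (psi x - k)) * (exp (- psi x) / Im)).
  { replace (2 * (psi x - k)) with (psi x + psi x + (ln Im + - ln Ip)) by (unfold k; field).
    rewrite !exp_plus, !exp_Ropp, !exp_ln by easy. field.
    repeat split; try lra. generalize (exp_pos (psi x)). lra. }
  unfold delta0, n0, p0. fold Ip Im.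
  replace (m0 * exp (psi x) / Ip) with (m0 * (exp (psi x) / Ip)) by (unfold Rdiv; ring).
  rewrite E.
  set (u := exp (- psi x) / Im).
  assert (Hu : 0 < u) by (apply Rdiv_lt_0_compat; [apply exp_pos | easy]).
  replace (m0 * exp (- psi x) / Im) with (m0 * u) by (unfold u, Rdiv; ring).
  replace ((m0 * (exp (2 * (psi x - k)) * u) - m0 * u) * psi x
            - k * (m0 * (exp (2 * (psi x - k)) * u) - m0 * u))
    with (m0 * u * ((exp (2 * (psi x - k)) - 1) * (psi x - k))) by ring.
  apply Rmult_le_pos; [apply Rmult_le_pos; lra |].
  destruct (Rle_dec 0 (psi x - k)) as [Hs | Hs].
  - apply Rmult_le_pos; [| easy]. generalize (exp_ineq1_le (2 * (psi x - k))). lra.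
  - assert (exp (2 * (psi x - k)) <= exp 0) by (left; apply exp_increasing; lra).
    rewrite exp_0 in H0. nra.
Qed.

(** Poisson's equation is stated as the value of the derivative of [psi'], so
    that it extends continuously to the boundary. *)
Definition steady_layer (eps gamma m0 phi1 : R) (psi psi' : R -> R) : Prop :=
  C1I psi psi' /\ C1I psi' (fun x => delta0 m0 psi x / eps) /\
  psi 1 + gamma * psi' 1 = phi1 /\ psi (-1) - gamma * psi' (-1) = - phi1.

Lemma steady_state_layer eps gamma m0 phi1 psi : 0 < eps ->
  steady_state eps gamma m0 phi1 psi ->
  steady_layer eps gamma m0 phi1 psi (deriv_I psi).
Proof.
  intros He (Hc & Heq & Hr & Hl).
  destruct (C2_closed_C1I psi Hc) as [H1 H2].
  split; [| split; [| split]]; try easy.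
  apply C1I_deriv_ext with (3 := H2).
  - intros x Hx. unfold delta0. rewrite <- Heq by easy. field. lra.
  - apply continuous_I_div, delta0_cont, H1.
Qed.

(** Conservation of the total pressure: the electrostatic pressure balances
    the ionic pressure n + p. *)
Lemma pressure_balance eps gamma m0 phi1 psi psi' x y : 0 < eps ->
  steady_layer eps gamma m0 phi1 psi psi' -> I11 x -> I11 y ->
  eps / 2 * psi' x ^ 2 - eta0 m0 psi x = eps / 2 * psi' y ^ 2 - eta0 m0 psi y.
Proof.
  intros He (H1 & H2 & _) Hx Hy.
  assert (HC : C1I (fun z => eps / 2 * (psi' z * psi' z) - eta0 m0 psi z)
    (fun z => eps / 2 * (delta0 m0 psi z / eps * psi' z + psi' z * (delta0 m0 psi z / eps))
              - delta0 m0 psi z * psi' z)).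
  { apply C1I_minus; [auto with contI | now apply eta0_C1I]. }
  assert (E := C1I_const_of_zero _ _ x y HC).
  rewrite <- !Rsqr_pow2. apply E; try easy.
  intros z _. field. lra.
Qed.

(** The constant in the pressure balance is found by averaging over the
    interval. In particular the field energy controls how far the total density
    can fall below m0. *)
Lemma eta0_field_energy eps gamma m0 phi1 psi psi' x : 0 < eps ->
  steady_layer eps gamma m0 phi1 psi psi' -> I11 x ->
  eta0 m0 psi x = eps / 2 * psi' x ^ 2
     + (m0 - eps / 4 * RInt (fun y => psi' y ^ 2) (-1) 1).
Proof.
  intros He Hs Hx. destruct (Hs) as (H1 & H2 & _).
  assert (Hc : continuous_I psi) by apply H1.
  assert (Hc' : continuous_I psi') by apply H1.
  set (C := eps / 2 * psi' x ^ 2 - eta0 m0 psi x).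
  assert (E : RInt (fun y => eps / 2 * psi' y ^ 2 - eta0 m0 psi y) (-1) 1 = 2 * C).
  { rewrite <- RInt_I_const. apply RInt_I_ext. intros y Hy.
    apply (pressure_balance eps gamma m0 phi1); auto with contI. }
  rewrite RInt_I_minus, RInt_I_scal, eta0_mass in E; auto with contI.
  unfold C in E. lra.
Qed.

(** The field energy of the layer is of order sqrt eps. Charge neutrality makes
    the boundary field q the same at both ends; testing the equation with psi
    bounds the energy by 2 eps q P, where P = psi(1) = - psi(-1), and the
    pressure balance bounds sqrt eps q. *)
Lemma field_energy_bound eps gamma m0 phi1 K psi psi' :
  0 < eps -> 0 < gamma -> 0 < m0 -> 0 < phi1 ->
  exp phi1 - 1 <= K -> K * (sqrt eps / cM m0 phi1) < 1 / 2 ->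
  steady_layer eps gamma m0 phi1 psi psi' ->
  eps * RInt (fun x => psi' x ^ 2) (-1) 1 <= 3 * m0 * (K * (sqrt eps / cM m0 phi1)).
Proof.
  intros He Hg Hm Hphi HK Hsmall Hs.
  destruct (Hs) as (H1 & H2 & Hr & Hl).
  assert (Hc : continuous_I psi) by apply H1.
  assert (Hc' : continuous_I psi') by apply H1.
  set (S := eps * RInt (fun x => psi' x ^ 2) (-1) 1).
  assert (HS0 : 0 <= S).
  { apply Rmult_le_pos; [lra |]. apply RInt_I_ge0; auto with contI.
    intros x _. apply pow2_ge_0. }
  assert (Hq : psi' 1 = psi' (-1)).
  { assert (E := RInt_deriv _ _ (-1) 1 H2 I11_left I11_right).
    rewrite (RInt_I_ext _ (fun x => / eps * delta0 m0 psi x)) in E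
      by (intros; unfold Rdiv; ring).
    rewrite RInt_I_scal, delta0_mass in E by auto with contI. lra. }
  set (q := psi' 1) in *. set (P := phi1 - gamma * q).
  assert (HP1 : psi 1 = P) by (unfold P; lra).
  assert (HPm : psi (-1) = - P) by (unfold P; rewrite <- Hq in Hl; lra).
  assert (HSq : S <= 2 * eps * q * P).
  { assert (E := RInt_deriv _ _ (-1) 1 (C1I_mult _ _ _ _ H1 H2) I11_left I11_right).
    rewrite (RInt_I_ext _ (fun x => psi' x ^ 2 + / eps * (delta0 m0 psi x * psi x))) in E
      by (intros; field; lra).
    rewrite RInt_I_plus, RInt_I_scal in E by auto 6 with contI.
    rewrite HP1, HPm, <- Hq in E. fold q in E.
    assert (Hn := delta0_psi_nonneg m0 psi Hm Hc).
    assert (Hn' : S + RInt (fun x => delta0 m0 psi x * psi x) (-1) 1 = 2 * eps * q * P).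
    { unfold S.
      transitivity (eps * (RInt (fun x => psi' x ^ 2) (-1) 1
        + / eps * RInt (fun x => delta0 m0 psi x * psi x) (-1) 1)); [field; lra |].
      rewrite E. ring. }
    lra. }
  assert (Hq0 : 0 <= q).
  { apply Rnot_lt_le. intros Hn. assert (0 < P) by (unfold P; nra).
    assert (0 < eps * (- q) * P) by (repeat apply Rmult_lt_0_compat; lra). nra. }
  assert (HPle : P <= phi1) by (unfold P; nra).
  set (s := sqrt eps) in *. set (M := cM m0 phi1) in *.
  assert (Hspos : 0 < s) by (apply sqrt_lt_R0; lra).
  assert (Hss : s * s = eps) by (apply sqrt_sqrt; lra).
  assert (HE1 : 1 + phi1 < exp phi1) by (apply exp_ineq1; lra).
  set (E := exp phi1) in *.
  assert (HMpos : 0 < M).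
  { apply sqrt_lt_R0, Rdiv_lt_0_compat; [easy |]. unfold E in *. lra. }
  assert (HMM : m0 = 2 * E * (M * M)).
  { unfold M, cM. fold E. rewrite sqrt_sqrt; [field; lra |].
    apply Rlt_le, Rdiv_lt_0_compat; lra. }
  assert (HKs : K * s < M / 2).
  { apply Rmult_lt_compat_r with (r := M) in Hsmall; [| easy].
    replace (K * (s / M) * M) with (K * s) in Hsmall by (field; lra). lra. }
  assert (Ha : 3 * m0 * (K * (s / M)) = 6 * E * M * K * s).
  { rewrite HMM. field. lra. }
  rewrite Ha.
  assert (HKpos : 0 < K) by lra.
  destruct (Rle_dec P 0) as [HP0 | HP0].
  { (* Here the bound 2 eps q P on the energy is nonpositive. *)
    assert (0 <= 6 * E * M * K * s) by (repeat apply Rmult_le_pos; lra).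
    assert (0 <= eps * q * - P) by (repeat apply Rmult_le_pos; lra). lra. }
  apply Rnot_le_lt in HP0.
  (* Equal pressures at the two ends force the two normalizations to agree. *)
  set (Ip := RInt (fun y => exp (psi y)) (-1) 1).
  set (Im := RInt (fun y => exp (- psi y)) (-1) 1).
  assert (HIp : 0 < Ip) by (apply RInt_I_gt0; auto with contI; intros; apply exp_pos).
  assert (HIm : 0 < Im) by (apply RInt_I_gt0; auto with contI; intros; apply exp_pos).
  assert (HI : Ip = Im).
  { assert (B := pressure_balance _ _ _ _ _ _ 1 (-1) He Hs I11_right I11_left).
    fold q in B. rewrite <- Hq in B. unfold eta0, n0, p0 in B. fold Ip Im in B.
    rewrite HP1, HPm, Ropp_involutive in B.
    assert (Hlt : exp (- P) < exp P) by (apply exp_increasing; lra).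
    assert (B' : m0 * (exp P - exp (- P)) * (/ Ip - / Im) = 0) by (unfold Rdiv in B; lra).
    apply Rmult_integral in B'. destruct B' as [B' | B'].
    - apply Rmult_integral in B'. lra.
    - rewrite <- (Rinv_inv Ip), <- (Rinv_inv Im). f_equal. lra. }
  assert (HI2 : 2 <= Ip).
  { assert (Hsum : 2 * 2 <= Ip + Im).
    { unfold Ip, Im. rewrite <- RInt_I_plus, <- (RInt_I_const 2) by auto with contI.
      apply RInt_I_le; auto with contI. intros x _.
      generalize (exp_ineq1_le (psi x)) (exp_ineq1_le (- psi x)). lra. }
    lra. }
  set (y := s * q).
  assert (Hy0 : 0 <= y) by (apply Rmult_le_pos; lra).
  assert (HSy : S <= 2 * s * (y * P)).
  { unfold y. replace (2 * s * (s * q * P)) with (2 * (s * s) * q * P) by ring.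
    now rewrite Hss. }
  assert (Heta : eta0 m0 psi 1 <= m0 * E).
  { unfold eta0, n0, p0. fold Ip Im. rewrite <- HI, HP1.
    assert (H3 : exp P <= E).
    { unfold E. destruct (Req_dec P phi1) as [-> | Hn]; [lra |].
      left. apply exp_increasing. lra. }
    assert (H4 : exp (- P) <= E).
    { left. apply exp_increasing. lra. }
    apply Rle_trans with ((m0 * E) * 2 / Ip).
    - unfold Rdiv. rewrite <- Rmult_plus_distr_r.
      apply Rmult_le_compat_r; [left; now apply Rinv_0_lt_compat |]. nra.
    - apply Rle_div_l; [easy |]. apply Rmult_le_compat_l; [nra | easy]. }
  assert (Hyy : y * y <= 2 * (m0 * E) + y * (s * P)).
  { assert (B := eta0_field_energy _ _ _ _ _ _ 1 He Hs I11_right). fold q in B.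
    replace (eps / 4 * RInt (fun y => psi' y ^ 2) (-1) 1) with (S / 4) in B
      by (unfold S; field).
    replace (y * y) with (eps * q ^ 2) by (unfold y; rewrite <- Hss; ring). nra. }
  assert (HsP : s * P <= M * E / 2).
  { apply Rle_trans with (s * K); [apply Rmult_le_compat_l; lra | nra]. }
  (* Since m0 = 2 E M^2, the inequality for y reads y^2 <= 4 (M E)^2 + y M E / 2,
     so that y < 3 M E. *)
  assert (Hy3 : y <= 3 * (M * E)).
  { apply Rnot_lt_le. intros Hn.
    assert (HME : 0 < M * E) by (apply Rmult_lt_0_compat; lra).
    assert (Hm4 : 2 * (m0 * E) = 4 * ((M * E) * (M * E))) by (rewrite HMM; ring).
    assert (y * (s * P) <= y * (M * E / 2)) by (apply Rmult_le_compat_l; lra).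
    nra. }
  apply Rle_trans with (1 := HSy).
  replace (6 * E * M * K * s) with (2 * s * (3 * (M * E) * K)) by ring.
  apply Rmult_le_compat_l; [lra |].
  apply Rmult_le_compat; lra.
Qed.

(** * The dissipation inequality at a fixed time *)

(** Integrating Poisson's equation once gives the field in terms of [D] up to a
    constant, which the Robin conditions determine. *)
Lemma perturbed_field eps gamma D delta phi phi' : 0 < eps -> 0 < gamma ->
  C1I D delta -> C1I phi phi' -> C1I phi' (fun x => delta x / eps) ->
  D (-1) = 0 -> D 1 = 0 ->
  phi 1 + gamma * phi' 1 = 0 -> phi (-1) - gamma * phi' (-1) = 0 ->
  forall x, I11 x ->
    phi' x = (D x - 1 / 2 * RInt D (-1) 1 / (1 + gamma)) / eps.
Proof.
  intros He Hg HD Hphi Hphi' HDl HDr Hr Hl.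
  assert (HcD : continuous_I D) by apply HD.
  set (c := eps * phi' (-1)).
  assert (E : forall x, I11 x -> phi' x = / eps * (D x + c)).
  { intros x Hx.
    assert (E := C1I_const_of_zero _ _ x (-1)
      (C1I_minus _ _ _ _ Hphi' (C1I_scal (/ eps) _ _ HD))).
    cbv beta in E. rewrite HDl in E. unfold c.
    transitivity (/ eps * D x + phi' (-1)); [| field; lra].
    assert (H0 : phi' x - / eps * D x = phi' (-1) - / eps * 0)
      by (apply E; auto with contI; intros; field; lra).
    lra. }
  assert (Hj := RInt_deriv _ _ (-1) 1 Hphi I11_left I11_right).
  rewrite (RInt_I_ext _ (fun x => / eps * (D x + c))) in Hj by auto with contI.
  rewrite RInt_I_scal, RInt_I_plus, RInt_I_const in Hj by auto with contI.
  assert (El := E _ I11_left). assert (Er := E _ I11_right).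
  rewrite HDl in El. rewrite HDr in Er.
  assert (Hc : c = - (1 / 2 * RInt D (-1) 1) / (1 + gamma)).
  { apply Rmult_eq_reg_r with (1 + gamma); [| lra].
    transitivity (- (1 / 2 * RInt D (-1) 1)); [| field; lra].
    assert (H0 : eps * (phi 1 - phi (-1)) = RInt D (-1) 1 + 2 * c)
      by (rewrite <- Hj; field; lra).
    assert (H1 : phi 1 - phi (-1) = - 2 * gamma * (/ eps * c)) by (rewrite El, Er in *; lra).
    rewrite H1 in H0.
    assert (H2 : eps * (- 2 * gamma * (/ eps * c)) = - 2 * gamma * c) by (field; lra).
    lra. }
  intros x Hx. rewrite E, Hc by easy. field. lra.
Qed.

(** The drift terms combine with the relation eps phi' = D + c into exact
    derivatives and the single cross term c psi' eta. That term is absorbed by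
    half of the dissipation of eta and by c^2 psi'^2 / 2; the mean d is
    controlled by the coercive term coming from the total density, whose
    variation about [mu] integrates to the small quantity 2 (m0 - mu). *)
Lemma dissipation_inequality eps gamma m0 phi1 mu psi psi' D H delta eta delta' eta' phi phi' :
  0 < eps -> 0 < gamma ->
  steady_layer eps gamma m0 phi1 psi psi' ->
  C1I D delta -> C1I H eta -> C1I delta delta' -> C1I eta eta' ->
  C1I phi phi' -> C1I phi' (fun x => delta x / eps) ->
  D (-1) = 0 -> D 1 = 0 -> H (-1) = 0 -> H 1 = 0 ->
  phi 1 + gamma * phi' 1 = 0 -> phi (-1) - gamma * phi' (-1) = 0 ->
  (forall x, I11 x -> mu <= eta0 m0 psi x) ->
  (1 + 2 * gamma) ^ 2 * (m0 - mu) + eps * RInt (fun x => psi' x ^ 2) (-1) 1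
    <= 4 * m0 * gamma * (1 + gamma) ->
  let d := 1 / 2 * RInt D (-1) 1 in
  RInt (fun x => D x * (delta' x - eta0 m0 psi x * phi' x - eta x * psi' x)
               + H x * (eta' x - delta0 m0 psi x * phi' x - delta x * psi' x)) (-1) 1
  <= - RInt (fun x => delta x ^ 2 + 1 / 2 * eta x ^ 2) (-1) 1
     - 1 / eps * mu * RInt (fun x => (D x - d) ^ 2) (-1) 1.
Proof.
  intros He Hg Hs HD HH Hdelta Heta Hphi Hphi' HDl HDr HHl HHr Hr Hl Hmu Hcond d.
  destruct (Hs) as (Hpsi & Hpsi' & _).
  assert (cD : continuous_I D) by apply HD.
  assert (cH : continuous_I H) by apply HH.
  assert (cde : continuous_I delta) by apply HD.
  assert (cet : continuous_I eta) by apply HH.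
  assert (cde' : continuous_I delta') by apply Hdelta.
  assert (cet' : continuous_I eta') by apply Heta.
  assert (cph' : continuous_I phi') by apply Hphi.
  assert (cps : continuous_I psi) by apply Hpsi.
  assert (cps' : continuous_I psi') by apply Hpsi.
  set (c := - d / (1 + gamma)).
  assert (Hfield : forall x, I11 x -> phi' x = (D x + c) / eps).
  { intros x Hx.
    rewrite (perturbed_field eps gamma D delta phi phi' He Hg HD Hphi Hphi' HDl HDr Hr Hl x Hx).
    fold d. unfold c. field. lra. }
  (* T = - D delta - H eta + psi' H (D + c) vanishes at both ends. *)
  assert (HT := RInt_deriv _ _ (-1) 1
    (C1I_plus _ _ _ _
      (C1I_minus _ _ _ _ (C1I_scal (-1) _ _ (C1I_mult _ _ _ _ HD Hdelta))
                         (C1I_mult _ _ _ _ HH Heta))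
      (C1I_mult _ _ _ _ (C1I_mult _ _ _ _ Hpsi' HH)
         (C1I_plus _ _ _ _ HD (C1I_const c)))) I11_left I11_right).
  cbv beta in HT. rewrite HDl, HDr, HHl, HHr in HT.
  set (T' := fun x => _) in HT.
  assert (cT' : continuous_I T') by (unfold T'; auto 12 with contI).
  assert (HT0 : RInt T' (-1) 1 = 0) by (rewrite HT; eq_R; ring).
  clear HT.
  (* What remains of the integrand, apart from T', after completing two squares:
     eta - c psi', and (D - d) + (2 d + c) / 2 with weight eta0 - mu. *)
  set (low := fun x => - (c ^ 2 / 2) * psi' x ^ 2
     + / eps * ((- ((2 * d + c) ^ 2 / 4) + d * (d + c)) * eta0 m0 psi x
        + mu * ((2 * d + c) ^ 2 / 4) + mu * (2 * d + c) * (D x - d))).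
  assert (clow : continuous_I low) by (unfold low; auto 12 with contI).
  assert (Hlow : 0 <= RInt low (-1) 1).
  { unfold low.
    rewrite RInt_I_plus, !RInt_I_scal by auto 12 with contI.
    rewrite !RInt_I_plus, !RInt_I_scal, RInt_I_minus, !RInt_I_const, eta0_mass
      by auto 12 with contI.
    replace (RInt D (-1) 1 - 2 * d) with 0 by (unfold d; field).
    set (F := RInt (fun x => psi' x ^ 2) (-1) 1) in *.
    match goal with |- 0 <= ?e => replace e with
      (d ^ 2 / (2 * eps * (1 + gamma) ^ 2) *
        (4 * m0 * gamma * (1 + gamma)
          - ((1 + 2 * gamma) ^ 2 * (m0 - mu) + eps * F)))
      by (unfold c; field; lra) end.
    apply Rmult_le_pos; [| lra].
    apply Rmult_le_pos; [apply pow2_ge_0 |].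
    left. apply Rinv_0_lt_compat.
    repeat apply Rmult_lt_0_compat; lra. }
  set (A := fun x => D x * (delta' x - eta0 m0 psi x * phi' x - eta x * psi' x)
               + H x * (eta' x - delta0 m0 psi x * phi' x - delta x * psi' x)).
  assert (cA : continuous_I A) by (unfold A; auto 12 with contI).
  assert (Hpt : RInt (fun x => T' x + low x) (-1) 1 <=
    RInt (fun x => - A x - (delta x ^ 2 + 1 / 2 * eta x ^ 2)
                   - 1 / eps * mu * (D x - d) ^ 2) (-1) 1).
  { apply RInt_I_le; [auto with contI | auto 12 with contI |].
    intros x Hx. unfold T', low, A.
    rewrite (Hfield x) by auto with contI.
    assert (Hg0 : 0 <= eta0 m0 psi x - mu)
      by (generalize (Hmu x (I11_inside x Hx)); lra).
    assert (Hie : 0 < / eps) by now apply Rinv_0_lt_compat.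
    apply Rminus_le.
    match goal with |- ?e <= 0 => replace e with
      (- (1 / 2 * (eta x - c * psi' x) ^ 2
         + / eps * ((eta0 m0 psi x - mu) * ((D x - d) + (2 * d + c) / 2) ^ 2)))
      by (field; lra) end.
    apply Ropp_le_cancel. rewrite Ropp_0, Ropp_involutive.
    apply Rplus_le_le_0_compat.
    - apply Rmult_le_pos; [lra | apply pow2_ge_0].
    - apply Rmult_le_pos; [lra |]. apply Rmult_le_pos; [lra | apply pow2_ge_0]. }
  rewrite RInt_I_plus, HT0 in Hpt by easy.
  rewrite !RInt_I_minus, RInt_I_scal in Hpt by auto 12 with contI.
  replace (RInt (fun x => - A x) (-1) 1) with (- RInt A (-1) 1) in Hpt.
  - fold A. lra.
  - rewrite (RInt_I_ext (fun x => - A x) (fun x => -1 * A x)) by (intros; ring).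
    rewrite RInt_I_scal by easy. eq_R. ring.
Qed.

(** * Differentiation in time *)

(** Functions of (t,x), extended in space by [clamp] when they come from the
    cylinder, so that continuity at the lateral boundary is two-sided. *)
Definition cont_2d (f : R -> R -> R) : Prop :=
  forall t x, 0 < t -> continuity_2d_pt f t x.

Lemma locally_pos t : 0 < t -> locally t (fun s => 0 < s).
Proof. intros Ht. apply (open_gt 0). exact Ht. Qed.

Lemma jointly_continuous_cont_2d u :
  jointly_continuous u -> cont_2d (fun t x => u (clamp x) t).
Proof.
  intros Hu t x Ht. apply continuity_2d_pt_filterlim.
  apply (filterlim_comp _ _ _ (fun z : R * R => (clamp (snd z), fst z))
    (fun p => u (fst p) (snd p)) _ (within cylinder (locally (clamp x, t)))).
  - intros P [d Hd].
    destruct (locally_pos t Ht) as [e He].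
    assert (Hm : 0 < Rmin d e) by (apply Rmin_pos; apply cond_pos).
    exists (mkposreal _ Hm). intros [s y] [Hs Hy]. simpl in *.
    apply Hd.
    + split; simpl.
      * apply Rle_lt_trans with (1 := clamp_lipschitz x y).
        apply Rlt_le_trans with (1 := Hy). apply Rmin_l.
      * apply Rlt_le_trans with (1 := Hs). apply Rmin_l.
    + split; simpl; [apply clamp_in |]. apply He.
      apply Rlt_le_trans with (1 := Hs). apply Rmin_r.
  - apply (Hu (clamp x, t)). split; [apply clamp_in | exact Ht].
Qed.

Lemma cont_2d_slice f t x : cont_2d f -> 0 < t -> continuous (f t) x.
Proof.
  intros Hf Ht. apply filterlim_locally. intros e.
  destruct (Hf t x Ht e) as [d Hd]. exists d. intros y Hy.
  apply Hd; [| exact Hy]. rewrite Rminus_diag, Rabs_R0. apply cond_pos.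
Qed.

Lemma jointly_continuous_slice u t :
  jointly_continuous u -> 0 < t -> continuous_I (fun x => u x t).
Proof.
  intros Hu Ht x. apply (cont_2d_slice _ t x (jointly_continuous_cont_2d u Hu) Ht).
Qed.

Lemma cont_2d_ex_RInt f t a b : cont_2d f -> 0 < t -> ex_RInt (f t) a b.
Proof.
  intros Hf Ht. apply (@ex_RInt_continuous R_CompleteNormedModule).
  intros z _. now apply cont_2d_slice.
Qed.

Lemma is_derive_RInt_time f f' a b t :
  (forall s x, 0 < s -> is_derive (fun r => f r x) s (f' s x)) ->
  cont_2d f -> cont_2d f' -> 0 < t ->
  is_derive (fun s => RInt (f s) a b) t (RInt (f' t) a b).
Proof.
  intros Hd Hf Hf' Ht.
  rewrite (RInt_ext (f' t) (fun x => Derive (fun s => f s x) t))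
    by (intros x _; symmetry; apply is_derive_unique, Hd, Ht).
  apply (is_derive_RInt_param f a b t).
  - apply filter_imp with (2 := locally_pos t Ht).
    intros s Hs x _. exists (f' s x). now apply Hd.
  - intros x _. apply continuity_2d_pt_ext_loc with (2 := Hf' t x Ht).
    destruct (locally_pos t Ht) as [e He]. exists e. intros s y Hs _.
    symmetry. apply is_derive_unique, Hd, He, Hs.
  - apply filter_imp with (2 := locally_pos t Ht).
    intros s Hs. now apply cont_2d_ex_RInt.
Qed.

(** The primitive in space varies little in time because [f] is uniformly
    continuous near the compact segment at time [t]. *)
Lemma cont_2d_RInt f a : cont_2d f -> cont_2d (fun t x => RInt (f t) a x).
Proof.
  intros Hf t x Ht e.
  set (lo := Rmin a x - 1). set (hi := Rmax a x + 1).
  assert (Hlo : lo <= a - 1 /\ lo <= x - 1)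
    by (unfold lo; generalize (Rmin_l a x) (Rmin_r a x); lra).
  assert (Hhi : a + 1 <= hi /\ x + 1 <= hi)
    by (unfold hi; generalize (Rmax_l a x) (Rmax_r a x); lra).
  assert (He2 : 0 < e / (2 * (hi - lo))).
  { apply Rdiv_lt_0_compat; [apply cond_pos | lra]. }
  destruct (uniform_continuity_2d_1d' f lo hi t (fun y _ => Hf t y Ht) (mkposreal _ He2))
    as [d1 Hd1].
  assert (Hprim : continuous (fun y => RInt (f t) a y) x).
  { apply (@ex_derive_continuous R_AbsRing R_NormedModule). exists (f t x).
    apply is_derive_RInt with a; [| now apply cont_2d_slice].
    apply filter_forall. intros y. apply (@RInt_correct R_CompleteNormedModule).
    now apply cont_2d_ex_RInt. }
  destruct (proj1 (filterlim_locally _ _) Hprim (pos_div_2 e)) as [d2 Hd2].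
  destruct (locally_pos t Ht) as [d3 Hd3].
  assert (Hm : 0 < Rmin (Rmin d1 d2) (Rmin d3 1))
    by (repeat apply Rmin_pos; try apply cond_pos; lra).
  exists (mkposreal _ Hm). simpl. intros s y Hs Hy.
  apply Rmin_Rgt_l in Hs. destruct Hs as [Hs12 Hs34].
  apply Rmin_Rgt_l in Hs12, Hs34.
  apply Rmin_Rgt_l in Hy. destruct Hy as [Hy12 Hy34].
  apply Rmin_Rgt_l in Hy12, Hy34.
  assert (Hs0 : 0 < s) by (apply Hd3; apply Hs34).
  assert (Hy1 : Rabs (y - x) < 1) by apply Hy34.
  apply Rabs_def2 in Hy1.
  assert (Hsd : Rabs (s - t) < d1) by apply Hs12. apply Rabs_def2 in Hsd.
  replace (RInt (f s) a y - RInt (f t) a x)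
    with (RInt (fun z => f s z - f t z) a y + (RInt (f t) a y - RInt (f t) a x)).
  2: { replace (RInt (fun z => f s z - f t z) a y)
         with (RInt (f s) a y - RInt (f t) a y).
       - eq_R. ring.
       - symmetry. apply (RInt_minus (f s) (f t)); now apply cont_2d_ex_RInt. }
  apply Rle_lt_trans with (1 := Rabs_triang _ _).
  assert (H2 : Rabs (RInt (f t) a y - RInt (f t) a x) < e / 2).
  { apply (Hd2 y). apply Hy12. }
  assert (H1 : Rabs (RInt (fun z => f s z - f t z) a y) <= e / 2).
  { eapply Rle_trans.
    - apply (norm_RInt_le_const_abs (V := R_CompleteNormedModule)
        (fun z => f s z - f t z) a y _ (e / (2 * (hi - lo)))).
      + intros z Hz.
        assert (lo <= z <= hi).
        { revert Hz. unfold Rmin, Rmax. destruct Rle_dec; lra. }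
        left. apply (Hd1 z t z s); try easy; try lra.
        rewrite Rminus_diag, Rabs_R0. apply cond_pos.
      + apply (@RInt_correct R_CompleteNormedModule).
        apply (ex_RInt_minus (f s) (f t)); now apply cont_2d_ex_RInt.
    - apply Rle_trans with ((hi - lo) * (e / (2 * (hi - lo)))).
      + apply Rmult_le_compat_r; [lra |].
        apply Rabs_le. lra.
      + right. field. lra. }
  lra.
Qed.

Lemma prim_clamp u x t : I11 x ->
  RInt (fun y => u (clamp y) t) (-1) x = prim u x t.
Proof. intros Hx. apply (RInt_clamp (fun y => u y t)); auto with contI. Qed.

Lemma RInt_C1I f : continuous_I f -> C1I (fun x => RInt f (-1) x) f.
Proof.
  intros Hf.
  assert (Hd : forall x, is_derive (fun y => RInt (fun z => f (clamp z)) (-1) y) x (f (clamp x))).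
  { intros x. apply (is_derive_RInt (fun z => f (clamp z)) _ (-1)); [| apply Hf].
    apply filter_forall. intros y. apply (@RInt_correct R_CompleteNormedModule).
    apply (@ex_RInt_continuous R_CompleteNormedModule). intros z _. apply Hf. }
  apply C1I_ext with (fun x => RInt (fun z => f (clamp z)) (-1) x) (fun x => f (clamp x)).
  - intros x Hx. apply RInt_clamp; auto with contI.
  - intros x Hx. now rewrite clamp_id.
  - split; [| split].
    + apply continuous_I_global. intros x.
      apply (@ex_derive_continuous R_AbsRing R_NormedModule). eexists. apply Hd.
    + apply continuous_I_global. exact Hf.
    + intros x _. apply Hd.
Qed.

Lemma prim_C1I u t : jointly_continuous u -> 0 < t ->
  C1I (fun x => prim u x t) (fun x => u x t).
Proof. intros Hu Ht. apply RInt_C1I. now apply jointly_continuous_slice. Qed.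

(** * Mass conservation *)

Lemma is_derive_prim u x t : C21 u -> 0 < t -> I11 x ->
  is_derive (fun s => prim u x s) t (RInt (fun y => d_t u y t) (-1) x).
Proof.
  intros (Hd & Hu & _ & _ & Ht) Hpos Hx.
  rewrite <- (RInt_clamp (fun y => d_t u y t)) by auto with contI.
  apply is_derive_ext with (fun s => RInt (fun y => u (clamp y) s) (-1) x).
  { intros s. now apply prim_clamp. }
  apply (is_derive_RInt_time (fun s y => u (clamp y) s) (fun s y => d_t u (clamp y) s)); auto.
  - intros s y Hs. apply (Derive_correct (fun r => u (clamp y) r)).
    apply Hd; [apply clamp_in | exact Hs].
  - now apply jointly_continuous_cont_2d.
  - now apply jointly_continuous_cont_2d.
Qed.

(** A mass that is constant for positive times keeps its initial value, which
    is attained in L^1. *)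
Lemma mass_zero u : C21 u -> attains_initial_data u ->
  RInt (fun x => u x 0) (-1) 1 = 0 ->
  (forall t, 0 < t -> RInt (fun x => d_t u x t) (-1) 1 = 0) ->
  forall t, 0 < t -> prim u 1 t = 0.
Proof.
  intros Hu [Hex Hlim] H0 Hz t Ht.
  assert (Hconst : forall s r, 0 < s -> s < r -> prim u 1 s = prim u 1 r).
  { intros s r Hs Hsr. apply (eq_is_derive (fun q => prim u 1 q)); [| exact Hsr].
    intros q Hq. assert (Hq0 : 0 < q) by lra.
    assert (D := is_derive_prim u 1 q Hu Hq0 I11_right).
    rewrite Hz in D by easy. exact D. }
  apply cond_eq. intros e He. rewrite Rminus_0_r.
  destruct (proj1 (filterlim_locally _ _) Hlim (mkposreal e He)) as [d Hd].
  set (s := Rmin (d / 2) (t / 2)).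
  assert (Hdp := cond_pos d).
  assert (Hs : 0 < s) by (apply Rmin_pos; lra).
  assert (Hst : s < t) by (unfold s; generalize (Rmin_r (d / 2) (t / 2)); lra).
  assert (Hsd : s < d) by (unfold s; generalize (Rmin_l (d / 2) (t / 2)); lra).
  rewrite <- (Hconst s t Hs Hst).
  assert (Hball : ball 0 d s).
  { change (Rabs (s - 0) < d). rewrite Rabs_pos_eq; lra. }
  specialize (Hd s Hball Hs).
  change (Rabs (RInt (fun x => Rabs (u x s - u x 0)) (-1) 1 - 0) < e) in Hd.
  rewrite Rminus_0_r in Hd.
  assert (Hexs : ex_RInt (fun x => u x s) (-1) 1).
  { apply ex_RInt_I; auto with contI. apply jointly_continuous_slice; [apply Hu | easy]. }
  assert (Hexd : ex_RInt (fun x => u x s - u x 0) (-1) 1)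
    by (apply (ex_RInt_minus (fun x => u x s) (fun x => u x 0)); easy).
  replace (prim u 1 s) with (RInt (fun x => u x s - u x 0) (-1) 1).
  - eapply Rle_lt_trans; [apply abs_RInt_le; [lra | exact Hexd] |].
    eapply Rle_lt_trans; [apply Rle_abs | exact Hd].
  - rewrite (RInt_minus (fun x => u x s) (fun x => u x 0)) by easy.
    rewrite H0. apply Rminus_0_r.
Qed.

(** * The energy *)

(** The means drop out: the energy is half the squared norm of the
    primitives. *)
Lemma energy_prim delta eta t :
  jointly_continuous delta -> jointly_continuous eta -> 0 < t ->
  energy delta eta t
  = RInt (fun x => 1 / 2 * (prim delta x t ^ 2 + prim eta x t ^ 2)) (-1) 1.
Proof.
  intros Hd He Ht.
  assert (cD := proj1 (prim_C1I delta t Hd Ht)).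
  assert (cH := proj1 (prim_C1I eta t He Ht)).
  unfold energy, prim_bar.
  set (d := prim_mean delta t). set (h := prim_mean eta t).
  rewrite (RInt_I_ext (fun x => (prim delta x t - d) ^ 2 + (prim eta x t - h) ^ 2)
    (fun x => (prim delta x t ^ 2 + prim eta x t ^ 2)
      - (2 * d * prim delta x t + 2 * h * prim eta x t) + (d ^ 2 + h ^ 2)))
    by (intros; ring).
  rewrite RInt_I_scal, RInt_I_plus, RInt_I_const, RInt_I_minus by auto 8 with contI.
  rewrite (RInt_I_plus (fun x => 2 * d * _)), !RInt_I_scal by auto 8 with contI.
  assert (Ed : RInt (fun x => prim delta x t) (-1) 1 = 2 * d)
    by (unfold d, prim_mean; lra).
  assert (Eh : RInt (fun x => prim eta x t) (-1) 1 = 2 * h)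
    by (unfold h, prim_mean; lra).
  rewrite Ed, Eh. eq_R. field.
Qed.

Lemma is_derive_energy delta eta t : C21 delta -> C21 eta -> 0 < t ->
  is_derive (energy delta eta) t
    (RInt (fun x => prim delta x t * RInt (fun y => d_t delta y t) (-1) x
                  + prim eta x t * RInt (fun y => d_t eta y t) (-1) x) (-1) 1).
Proof.
  intros Hd He Ht.
  apply is_derive_ext_loc with
    (fun s => RInt (fun x => 1 / 2 * (prim delta (clamp x) s ^ 2 + prim eta (clamp x) s ^ 2)) (-1) 1).
  { apply filter_imp with (2 := locally_pos t Ht). intros s Hs.
    rewrite energy_prim by (apply Hd || apply He || easy).
    apply RInt_I_ext. intros x Hx. rewrite clamp_id; auto with contI. }
  set (P := fun u s x => RInt (fun y => d_t u y s) (-1) (clamp x)).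
  rewrite (RInt_I_ext _ (fun x => prim delta (clamp x) t * P delta t x
     + prim eta (clamp x) t * P eta t x))
    by (intros x Hx; unfold P; rewrite clamp_id; auto with contI).
  assert (Hc : forall u, jointly_continuous u ->
    cont_2d (fun s x => RInt (fun y => u y s) (-1) (clamp x))).
  { intros u Hu s x Hs. apply continuity_2d_pt_ext with
      (fun s x => RInt (fun y => u (clamp y) s) (-1) (clamp x)).
    - intros r z. apply (RInt_clamp (fun y => u y r)); [apply I11_left | apply clamp_in].
    - assert (H := cont_2d_RInt _ (-1) (jointly_continuous_cont_2d u Hu) s (clamp x) Hs).
      intros e. destruct (H e) as [r Hr]. exists r. intros s' x' Hs' Hx'.
      apply Hr; [exact Hs' |].
      apply Rle_lt_trans with (1 := clamp_lipschitz x x'). exact Hx'. }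
  assert (HcD : forall u, C21 u -> cont_2d (fun s x => prim u (clamp x) s))
    by (intros u Hu; apply Hc, Hu).
  assert (HcD2 : forall u, C21 u -> cont_2d (fun s x => prim u (clamp x) s ^ 2)).
  { intros u Hu s x Hs.
    apply continuity_2d_pt_ext with (fun s x => prim u (clamp x) s * prim u (clamp x) s).
    - intros r z. apply Rsqr_pow2.
    - apply continuity_2d_pt_mult; now apply HcD. }
  assert (HcP : forall u, C21 u -> cont_2d (P u)) by (intros u Hu; apply Hc, Hu).
  apply (is_derive_RInt_time
    (fun s x => 1 / 2 * (prim delta (clamp x) s ^ 2 + prim eta (clamp x) s ^ 2))
    (fun s x => prim delta (clamp x) s * P delta s x + prim eta (clamp x) s * P eta s x)); auto.
  - intros s x Hs.
    assert (D1 := is_derive_prim delta (clamp x) s Hd Hs (clamp_in x)).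
    assert (D2 := is_derive_prim eta (clamp x) s He Hs (clamp_in x)).
    auto_derive.
    + split; [eexists; exact D1 | split; [eexists; exact D2 | easy]].
    + replace (Derive (fun r : R => prim delta (clamp x) r) s) with (P delta s x)
        by (symmetry; apply is_derive_unique, D1).
      replace (Derive (fun r : R => prim eta (clamp x) r) s) with (P eta s x)
        by (symmetry; apply is_derive_unique, D2).
      field.
  - intros s x Hs.
    apply (continuity_2d_pt_mult (fun _ _ => 1 / 2)); [apply continuity_2d_pt_const |].
    apply continuity_2d_pt_plus; apply HcD2; easy.
  - intros s x Hs.
    apply continuity_2d_pt_plus; apply continuity_2d_pt_mult; (now apply HcD) || (now apply HcP).
Qed.

Lemma C21_C1I u t : C21 u -> 0 < t -> C1I (fun x => u x t) (fun x => d_x u x t).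
Proof.
  intros (Hd & H1 & H2 & _) Ht. split; [| split].
  - now apply jointly_continuous_slice.
  - now apply jointly_continuous_slice.
  - intros x Hx. apply (deriv_I_inside (fun y => u y t)); [easy |].
    exact (proj1 (Hd x t (I11_inside x Hx) Ht)).
Qed.

Lemma C21_d_x_C1I u t : C21 u -> 0 < t -> C1I (fun x => d_x u x t) (fun x => d_xx u x t).
Proof.
  intros (Hd & _ & H2 & H3 & _) Ht. split; [| split].
  - now apply jointly_continuous_slice.
  - now apply jointly_continuous_slice.
  - intros x Hx. apply (deriv_I_inside (fun y => d_x u y t)); [easy |].
    exact (proj1 (proj2 (Hd x t (I11_inside x Hx) Ht))).
Qed.

(** Each evolution equation is a conservation law: with no flux through the
    left end, the time derivative of the primitive is the flux. *)
Lemma flux_primitive u a a' b b' f f' g g' t :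
  C21 u -> 0 < t ->
  C1I a a' -> C1I f f' -> C1I b b' -> C1I g g' ->
  (forall x, -1 < x < 1 -> d_t u x t = d_xx u x t
     - deriv_I (fun y => a y * f y) x - deriv_I (fun y => b y * g y) x) ->
  d_x u (-1) t - a (-1) * f (-1) - b (-1) * g (-1) = 0 ->
  forall x, I11 x ->
    RInt (fun y => d_t u y t) (-1) x = d_x u x t - a x * f x - b x * g x.
Proof.
  intros Hu Ht Ha Hf Hb Hg Heq Hflux x Hx.
  assert (Haf := C1I_mult _ _ _ _ Ha Hf).
  assert (Hbg := C1I_mult _ _ _ _ Hb Hg).
  assert (HF := C1I_minus _ _ _ _
    (C1I_minus _ _ _ _ (C21_d_x_C1I u t Hu Ht) Haf) Hbg).
  assert (HF' : C1I (fun y => d_x u y t - a y * f y - b y * g y) (fun y => d_t u y t)).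
  { apply C1I_deriv_ext with (3 := HF).
    - intros y Hy. rewrite Heq by easy.
      rewrite (deriv_I_eq _ y _ Hy (proj2 (proj2 Haf) y Hy)),
        (deriv_I_eq _ y _ Hy (proj2 (proj2 Hbg) y Hy)).
      reflexivity.
    - apply jointly_continuous_slice; [apply Hu | easy]. }
  rewrite (RInt_deriv _ _ (-1) x HF' I11_left Hx), Hflux. apply Rminus_0_r.
Qed.

(** * The decay estimate *)

Theorem theorem1p1 :
  forall m0 phi1 : R, 0 < m0 -> 0 < phi1 ->
  exists eps_tilde : R, 0 < eps_tilde /\
  forall eps : R, 0 < eps < eps_tilde ->
    m0eps m0 phi1 eps > m0 / 2 /\
    forall gamma_max gamma : R,
      0 < gamma_max ->
      0 < gamma <= gamma_max ->
      gamma / sqrt eps >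
        ((1 + 2 * gamma_max) ^ 2 + 3) * cK0 phi1 * phi1 / (4 * cM m0 phi1) ->
    forall psi : R -> R, steady_state eps gamma m0 phi1 psi ->
    forall delta eta phi : R -> R -> R,
      LP_solution eps gamma m0 psi delta eta phi ->
      RInt (fun x => delta x 0) (-1) 1 = 0 ->
      RInt (fun x => eta x 0) (-1) 1 = 0 ->
    forall t : R, 0 < t ->
      ex_derive (energy delta eta) t /\
      Derive (energy delta eta) t <=
        - RInt (fun x => d_x (prim_bar delta) x t ^ 2
                         + 1 / 2 * d_x (prim_bar eta) x t ^ 2) (-1) 1
        - 1 / eps * m0eps m0 phi1 eps
          * RInt (fun x => prim_bar delta x t ^ 2) (-1) 1.
Proof.
  intros m0 phi1 Hm Hphi.
  assert (HK := cK0_bound phi1 Hphi).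
  set (K := cK0 phi1 * phi1) in *.
  assert (HKpos : 0 < K) by (generalize (exp_ineq1 phi1); lra).
  set (M := cM m0 phi1).
  assert (HM : 0 < M).
  { apply sqrt_lt_R0, Rdiv_lt_0_compat; [easy |]. generalize (exp_pos phi1). lra. }
  (* This threshold means K sqrt eps / M < 1 / 2. *)
  exists ((M / (2 * K)) ^ 2).
  split; [apply pow_lt, Rdiv_lt_0_compat; lra |].
  intros eps [He Heps].
  assert (Hs : sqrt eps < M / (2 * K)).
  { rewrite <- (sqrt_pow2 (M / (2 * K))) by (left; apply Rdiv_lt_0_compat; lra).
    apply sqrt_lt_1; [lra | apply pow2_ge_0 | easy]. }
  assert (Hspos : 0 < sqrt eps) by now apply sqrt_lt_R0.
  set (a := K * (sqrt eps / M)).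
  assert (Ha : a < 1 / 2).
  { replace (1 / 2) with (K * (M / (2 * K) / M)) by (field; lra).
    apply Rmult_lt_compat_l; [easy |].
    apply Rmult_lt_compat_r; [now apply Rinv_0_lt_compat | easy]. }
  assert (Hapos : 0 < a).
  { apply Rmult_lt_0_compat; [easy |]. now apply Rdiv_lt_0_compat. }
  assert (Hmu : m0eps m0 phi1 eps = m0 * (1 - a)) by reflexivity.
  split; [rewrite Hmu; nra |].
  intros gm gamma Hgm [Hg Hgle] Hcond psi Hpsi delta eta phi
    (Hdelta & Heta & Hphi2 & Hid & Hie & Heq & Hnf & Hrob) Hm1 Hm2 t Ht.
  assert (Hgamma : ((1 + 2 * gm) ^ 2 + 3) * a < 4 * gamma).
  { apply Rmult_lt_compat_r with (r := 4 * sqrt eps) in Hcond; [| lra].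
    replace (gamma / sqrt eps * (4 * sqrt eps)) with (4 * gamma) in Hcond by (field; lra).
    apply Rle_lt_trans with (2 := Hcond). right. unfold a, K. fold M. field. lra. }
  assert (Hlayer := steady_state_layer eps gamma m0 phi1 psi He Hpsi).
  assert (HS := field_energy_bound eps gamma m0 phi1 K psi _ He Hg Hm Hphi HK Ha Hlayer).
  fold M a in HS.
  assert (Hlow : forall x, I11 x -> m0eps m0 phi1 eps <= eta0 m0 psi x).
  { intros x Hx. rewrite (eta0_field_energy eps gamma m0 phi1 psi _ x He Hlayer Hx), Hmu.
    assert (0 <= eps / 2 * deriv_I psi x ^ 2)
      by (apply Rmult_le_pos; [lra | apply pow2_ge_0]).
    nra. }
  assert (Hbalance : (1 + 2 * gamma) ^ 2 * (m0 - m0eps m0 phi1 eps)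
      + eps * RInt (fun x => deriv_I psi x ^ 2) (-1) 1 <= 4 * m0 * gamma * (1 + gamma)).
  { rewrite Hmu.
    assert ((1 + 2 * gamma) ^ 2 <= (1 + 2 * gm) ^ 2) by (apply pow_incr; lra).
    assert ((1 + 2 * gamma) ^ 2 * (m0 * a) <= (1 + 2 * gm) ^ 2 * (m0 * a))
      by (apply Rmult_le_compat_r; [nra | easy]).
    assert (m0 * (((1 + 2 * gm) ^ 2 + 3) * a) <= m0 * (4 * gamma))
      by (apply Rmult_le_compat_l; lra).
    assert (0 <= 4 * m0 * gamma * gamma) by (repeat apply Rmult_le_pos; lra).
    lra. }
  destruct Hlayer as (Hp1 & Hp2 & Hp3 & Hp4).
  assert (Heta0 : C1I (eta0 m0 psi) (fun x => delta0 m0 psi x * deriv_I psi x))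
    by now apply eta0_C1I.
  assert (Hdelta0 : C1I (delta0 m0 psi) (fun x => eta0 m0 psi x * deriv_I psi x))
    by now apply delta0_C1I.
  assert (Hfluxes : forall s, 0 < s ->
    (forall x, I11 x -> RInt (fun y => d_t delta y s) (-1) x
      = d_x delta x s - eta0 m0 psi x * d_x phi x s - eta x s * deriv_I psi x) /\
    (forall x, I11 x -> RInt (fun y => d_t eta y s) (-1) x
      = d_x eta x s - delta0 m0 psi x * d_x phi x s - delta x s * deriv_I psi x)).
  { intros s Hs0.
    destruct (C2_closed_C1I _ (Hphi2 s Hs0)) as [_ Hphi3].
    destruct (Hnf (-1) s (or_introl eq_refl) Hs0) as [N1 N2].
    split.
    - apply (flux_primitive delta _ _ _ _ (fun x => d_x phi x s) _ _ _ s Hdelta Hs0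
        Heta0 Hphi3 (C21_C1I eta s Heta Hs0) Hp2); [| exact N1].
      intros x Hx. exact (proj1 (Heq x s Hx Hs0)).
    - apply (flux_primitive eta _ _ _ _ (fun x => d_x phi x s) _ _ _ s Heta Hs0
        Hdelta0 Hphi3 (C21_C1I delta s Hdelta Hs0) Hp2); [| exact N2].
      intros x Hx. exact (proj1 (proj2 (Heq x s Hx Hs0))). }
  assert (HD1 : prim delta 1 t = 0).
  { apply mass_zero; try easy. intros s Hs0.
    rewrite (proj1 (Hfluxes s Hs0) 1 I11_right).
    exact (proj1 (Hnf 1 s (or_intror eq_refl) Hs0)). }
  assert (HH1 : prim eta 1 t = 0).
  { apply mass_zero; try easy. intros s Hs0.
    rewrite (proj2 (Hfluxes s Hs0) 1 I11_right).
    exact (proj2 (Hnf 1 s (or_intror eq_refl) Hs0)). }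
  assert (HE := is_derive_energy delta eta t Hdelta Heta Ht).
  split; [eexists; exact HE |].
  rewrite (is_derive_unique _ _ _ HE).
  rewrite (RInt_I_ext _ (fun x =>
      prim delta x t * (d_x delta x t - eta0 m0 psi x * d_x phi x t - eta x t * deriv_I psi x)
    + prim eta x t * (d_x eta x t - delta0 m0 psi x * d_x phi x t - delta x t * deriv_I psi x))).
  2: { intros x Hx. destruct (Hfluxes t Ht) as [F1 F2].
       rewrite F1, F2; auto with contI. }
  assert (Hbar : forall u x, C21 u -> -1 < x < 1 -> d_x (prim_bar u) x t = u x t).
  { intros u x Hu Hx. apply deriv_I_eq; [easy |].
    assert (HC : C1I (fun y => prim u y t - prim_mean u t) (fun y => u y t - 0))
      by (apply C1I_minus; [apply prim_C1I; [apply Hu | easy] | apply C1I_const]).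
    destruct HC as (_ & _ & HC). rewrite <- (Rminus_0_r (u x t)). now apply HC. }
  rewrite (RInt_I_ext (fun x => d_x (prim_bar delta) x t ^ 2 + _)
    (fun x => delta x t ^ 2 + 1 / 2 * eta x t ^ 2))
    by (intros x Hx; now rewrite !Hbar by easy).
  destruct (C2_closed_C1I _ (Hphi2 t Ht)) as [Hphi3 Hphi4].
  destruct (Hrob t Ht) as [R1 R2].
  apply (dissipation_inequality eps gamma m0 phi1 (m0eps m0 phi1 eps) psi (deriv_I psi)
    (fun x => prim delta x t) (fun x => prim eta x t) (fun x => delta x t) (fun x => eta x t)
    (fun x => d_x delta x t) (fun x => d_x eta x t) (fun x => phi x t) (fun x => d_x phi x t));
    try easy.
  - apply prim_C1I; [apply Hdelta | easy].
  - apply prim_C1I; [apply Heta | easy].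
  - now apply C21_C1I.
  - now apply C21_C1I.
  - apply C1I_deriv_ext with (3 := Hphi4).
    + intros x Hx. destruct (Heq x t Hx Ht) as (_ & _ & E). rewrite <- E.
      change (d_xx phi x t = eps * d_xx phi x t / eps). field. lra.
    + apply continuous_I_div. exact (proj1 (C21_C1I delta t Hdelta Ht)).
  - apply (@RInt_point R_CompleteNormedModule).
  - apply (@RInt_point R_CompleteNormedModule).
Qed.
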